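(* For every positive integer $n$, the pegging number of the hypercube $Q_n$ is $P(Q_n) = 2^{n-1}+1$.
   Context: $Q_n$ is the Cartesian product of $n$ copies of $K_2$, i.e. the graph on binary $n$-tuples with two tuples adjacent iff they differ in exactly one coordinate. A distribution of pegs on a graph $\Gamma$ is a subset $D \subseteq V(\Gamma)$. If $u,v \in D$ are distinct adjacent vertices and $w \notin D$ is a vertex adjacent to $v$, the pegging move (jumping $u$ over $v$ into $w$) replaces $D$ by $(D\setminus\{u,v\})\cup\{w\}$. A vertex $t$ is reachable from $D$ if some finite (possibly empty) sequence of pegging moves starting from $D$ ends in a distribution containing $t$; $\mathrm{Reach}(D)$ is the set of reachable vertices. The pegging number $P(\Gamma)$ is the smallest positive integer $d$ such that every distribution of size $d$ on $\Gamma$ has reach $V(\Gamma)$. *)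

(* Defs.v *)
From mathcomp Require Import all_boot.

Set Implicit Arguments.
Unset Strict Implicit.
Unset Printing Implicit Defensive.

Record sgraph := SGraph {
  vertex : finType;
  adj : rel vertex;
  adj_sym : symmetric adj;
  adj_irrefl : irreflexive adj
}.

Section Pegging.

Variable G : sgraph.
Implicit Types (D E : {set vertex G}) (t : vertex G).

(* u jumps over v into w; u != v because adjacency is irreflexive. *)
Definition pegging_move D E : bool :=
  [exists u, exists v, exists w,
    [&& u \in D, v \in D, adj u v, w \notin D, adj v w
      & E == w |: (D :\: [set u; v])]].

Definition Reach D : {set vertex G} :=
  [set t | [exists E, connect pegging_move D E && (t \in E)]].

Definition pegging_bound (d : nat) : bool :=
  (0 < d) && [forall D : {set vertex G}, (#|D| == d) ==> (Reach D == [set: vertex G])].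

(* Beyond the number of vertices there are no distributions at all. *)
Lemma ex_pegging_bound : exists d, pegging_bound d.
Proof.
exists #|vertex G|.+1; apply/andP; split=> //; apply/forallP => D.
by apply/implyP => /eqP cardD; have := max_card D; rewrite cardD ltnn.
Qed.

Definition pegging_number : nat := ex_minn ex_pegging_bound.

End Pegging.

Section Hypercube.

Variable n : nat.

Definition hypercube_adj (x y : n.-tuple bool) : bool :=
  #|[set i | tnth x i != tnth y i]| == 1.

Lemma hypercube_adj_sym : symmetric hypercube_adj.
Proof.
by move=> x y; congr (_ == 1); apply: eq_card => i; rewrite !inE eq_sym.
Qed.

Lemma hypercube_adj_irrefl : irreflexive hypercube_adj.
Proof.
move=> x; rewrite /hypercube_adj (_ : [set i | _] = set0) ?cards0 //.
by apply/setP => i; rewrite !inE eqxx.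
Qed.

Definition hypercube : sgraph := SGraph hypercube_adj_sym hypercube_adj_irrefl.

End Hypercube.

(* Main.v *)
Require Import Defs.
From mathcomp Require Import all_boot zify.

(** Split the cube along its first coordinate into columns of two vertices
    indexed by the points of Q_(n-1). A full column can send one peg into any
    neighbouring column that is not full, at a free height, so pegs behave like
    pebbles on Q_(n-1) with at most two pebbles per vertex. Chung's theorem, that
    2^(n-1) pebbles on Q_(n-1) reach any vertex, is proved for unordered multisets
    of moves satisfying a balance condition; a counting argument shows that such
    a multiset can always be ordered so that no vertex ever holds more than two
    pebbles. Conversely no move is possible within the 2^(n-1) even vertices. *)

Set Implicit Arguments.
Unset Strict Implicit.
Unset Printing Implicit Defensive.

(** * Unordered multisets of pebbling moves *)

Section Flow.

Variables (V : finType) (e : rel V).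
Implicit Types (p q r : V -> nat) (s : seq (V * V)) (A : {set V}).

Definition outflow s v := count (fun m => m.1 == v) s.
Definition inflow s v := count (fun m => m.2 == v) s.

(* The moves of [s] need not be playable in the order of the list. *)
Definition flow_by s p q :=
  all (fun m => e m.1 m.2) s /\
  forall v, q v + 2 * outflow s v <= p v + inflow s v.

Definition flow p q := exists s, flow_by s p q.

Lemma flow_le p q : (forall v, q v <= p v) -> flow p q.
Proof. by move=> le_qp; exists [::]; split=> // v; rewrite muln0 !addn0. Qed.

Lemma flow_trans q p r : flow p q -> flow q r -> flow p r.
Proof.
move=> [s [es sP]] [s' [es' sP']]; exists (s ++ s').
split=> [|v]; first by rewrite all_cat es.
by have := sP v; have := sP' v; rewrite /outflow /inflow !count_cat; lia.
Qed.

Lemma flow_add p q p' q' :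
  flow p q -> flow p' q' ->
  flow (fun v => p v + p' v) (fun v => q v + q' v).
Proof.
move=> [s [es sP]] [s' [es' sP']]; exists (s ++ s').
split=> [|v]; first by rewrite all_cat es.
by have := sP v; have := sP' v; rewrite /outflow /inflow !count_cat; lia.
Qed.

Lemma flow_sum (I : Type) (l : seq I) (p q : I -> V -> nat) :
  (forall i, flow (p i) (q i)) ->
  flow (fun v => \sum_(i <- l) p i v) (fun v => \sum_(i <- l) q i v).
Proof.
move=> pq; elim: l => [|i l IHl]; first by apply: flow_le => v; rewrite !big_nil.
apply: flow_trans (flow_trans (flow_add (pq i) IHl) _).
  by apply: flow_le => v; rewrite big_cons.
by apply: flow_le => v; rewrite big_cons.
Qed.

Lemma flow_move k u w :
  e u w -> flow (fun v => 2 * k * (v == u)) (fun v => k * (v == w)).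
Proof.
move=> euw; exists (nseq k (u, w)); split=> [|v].
  by rewrite all_nseq /= euw orbT.
rewrite /outflow /inflow !count_nseq /= ![_ == v]eq_sym; lia.
Qed.

Lemma sum_count (f : V * V -> V) s A :
  \sum_(v in A) count (fun m => f m == v) s = count (fun m => f m \in A) s.
Proof.
elim: s => [|m s IHs]; first by rewrite big1.
rewrite /= big_split /= IHs; congr (_ + _).
have [fA | fA] := boolP (f m \in A); last first.
  by apply: big1 => v vA; case: eqP => // fv; rewrite fv vA in fA.
rewrite (bigD1 (f m)) //= eqxx big1 // => v /andP[_].
by rewrite eq_sym => /negPf->.
Qed.

(* Otherwise the vertices [w] with [p w <= 1] that are [t] or emit a move would
   form a set closed under predecessors, on which moves lose more pebbles than
   are present. *)
Lemma flow_capped_move s p t :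
  p t = 0 -> flow_by s p (fun v => v == t) ->
  exists2 m, m \in s & (2 <= p m.1) && (p m.2 <= 1).
Proof.
move=> pt0 [_ sP]; apply/hasP; apply/negPn/negP => /hasPn noMove.
pose A := [set w | (p w <= 1) && ((w == t) || (0 < outflow s w))].
have tA : t \in A by rewrite inE pt0 eqxx.
have closedA m : m \in s -> m.2 \in A -> m.1 \in A.
  move=> sm; rewrite !inE => /andP[pm2 _]; have := noMove m sm.
  rewrite pm2 andbT -ltnNge ltnS => -> /=; apply/orP; right.
  by rewrite -has_count; apply/hasP; exists m.
(* Both sums count moves of [s], by target and by source, and [closedA] puts the source in [A]
   whenever the target is. *)
have inA : \sum_(v in A) inflow s v <= \sum_(v in A) outflow s v.
  rewrite !sum_count -!size_filter -!sum1_size !big_filter.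
  rewrite big_seq_cond [leqRHS]big_seq_cond.
  rewrite !sum1_count; apply: sub_count => m /= /andP[sm mA].
  by rewrite sm closedA.
(* On [A] the pile [p v] is at most [outflow s v]: it is empty at [t], and elsewhere in [A] it has
   at most one pebble while some move leaves. The extra 1 at [t] then contradicts [inA]. *)
have : \sum_(v in A) ((v == t) + (outflow s v + outflow s v)) <=
       \sum_(v in A) (outflow s v + inflow s v).
  apply: leq_sum => v; rewrite inE => /andP[pv out_v].
  rewrite addnn -mul2n; apply: leq_trans (sP v) _; rewrite leq_add2r.
  have [-> | v_neq_t] := eqVneq v t; first by rewrite pt0.
  by move: out_v; rewrite (negPf v_neq_t) /=; apply: leq_trans.
rewrite !big_split /= (bigD1 t) //= eqxx; lia.
Qed.

(** Used to play one move of the multiset: the others still balance on any [p'] that holds at least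
    what [m] leaves of [p]. *)
Lemma flow_by_rem s p p' q m :
  m \in s -> flow_by s p q ->
  (forall v, p v + (v == m.2) <= p' v + 2 * (v == m.1)) ->
  flow_by (rem m s) p' q.
Proof.
move=> sm [es sP] pp'; have s_perm := perm_to_rem sm; split=> [|v].
  by move: es; rewrite (perm_all _ s_perm) => /andP[].
have := sP v; have := pp' v.
rewrite /outflow /inflow !(permP s_perm) /= ![v == _]eq_sym; lia.
Qed.

(** Serves to choose a prescribed total number of pairs from piles containing [h v] pairs each. *)
Lemma exists_le_sum (h : V -> nat) c :
  c <= \sum_v h v ->
  exists2 k : V -> nat, forall v, k v <= h v & \sum_v k v = c.
Proof.
elim: c => [|c IHc] le_c; first by exists (fun=> 0); rewrite // big1.
have [k le_kh sum_k] := IHc (ltnW le_c).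
have [/existsP[v lt_v] | /existsPn ge_kh] := boolP [exists v, k v < h v].
  exists (fun x => k x + (x == v)) => [x|].
    by case: eqP => [-> | _]; rewrite ?addn1 ?addn0.
  rewrite big_split /= sum_k (bigD1 v) //= eqxx big1 ?addn1 // => x.
  by move/negPf->.
suff: \sum_v h v <= c by rewrite leqNgt le_c.
by rewrite -sum_k; apply: leq_sum => v _; rewrite leqNgt ge_kh.
Qed.

Definition odd_number p := \sum_v odd (p v).

Lemma sum_half p : 2 * (\sum_v (p v)./2) + odd_number p = \sum_v p v.
Proof.
rewrite big_distrr /= -big_split /=; apply: eq_bigr => v _.
by rewrite addnC mul2n odd_double_half.
Qed.

End Flow.

(** * Hypercubes *)

Definition tcons m (b : bool) (x : m.-tuple bool) : m.+1.-tuple bool :=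
  [tuple of b :: x].

Local Notation "b :+: x" := (tcons b x) (at level 60).

Lemma tconsP m (x : m.+1.-tuple bool) : exists b y, x = b :+: y.
Proof. by case/tupleP: x => b y; exists b, y. Qed.

Lemma eq_tcons m b c (x y : m.-tuple bool) :
  (b :+: x == c :+: y) = (b == c) && (x == y).
Proof. by rewrite -val_eqE /= eqseq_cons. Qed.

Lemma hypercube_adj_cons m b c (x y : m.-tuple bool) :
  hypercube_adj (b :+: x) (c :+: y) =
  if b == c then hypercube_adj x y else x == y.
Proof.
rewrite /hypercube_adj /tcons.
have -> : #|[set i | tnth (b :+: x) i != tnth (c :+: y) i]| =
          (b != c) + #|[set i | tnth x i != tnth y i]|.
  rewrite -!sum1dep_card big_mkcond big_ord_recl !tnth0.
  rewrite [in RHS]big_mkcond; congr (_ + _).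
  by apply: eq_bigr => i _; rewrite !tnthS.
case: (eqVneq b c) => _; rewrite ?add0n // add1n eqSS cards_eq0.
apply/eqP/eqP => [/setP xy | ->]; last by apply/setP => i; rewrite !inE eqxx.
by apply: eq_from_tnth => i; have := xy i; rewrite !inE => /negPn/eqP.
Qed.

Lemma sum_tupleS m b (F : m.+1.-tuple bool -> nat) :
  \sum_x F x =
  \sum_(x : m.-tuple bool) F (b :+: x) +
  \sum_(x : m.-tuple bool) F (~~ b :+: x).
Proof.
rewrite (reindex (fun z : bool * m.-tuple bool => z.1 :+: z.2)) /=.
  rewrite -(pair_bigA _ (fun c (x : m.-tuple bool) => F (c :+: x))) /= big_bool.
  by case: b; rewrite // addnC.
exists (fun x => (thead x, [tuple of behead x])) => [[c x] _ | x _].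
  by congr (_, _); apply: val_inj.
by rewrite [RHS]tuple_eta; apply: val_inj.
Qed.

Section Lift.

Variables (m : nat) (b : bool).
Implicit Types p q k : m.-tuple bool -> nat.

Definition lift_face p (x : m.+1.-tuple bool) :=
  if thead x == b then p [tuple of behead x] else 0.

Lemma lift_faceE p c (x : m.-tuple bool) :
  lift_face p (c :+: x) = if c == b then p x else 0.
Proof. by rewrite /lift_face theadE; congr (if _ then p _ else _); apply: val_inj. Qed.

Lemma flow_lift p q :
  flow (@hypercube_adj m) p q ->
  flow (@hypercube_adj m.+1) (lift_face p) (lift_face q).
Proof.
case=> s [es sP]; exists [seq (b :+: z.1, b :+: z.2) | z <- s].
split=> [|x].
  by rewrite all_map; apply: sub_all es => z /=; rewrite hypercube_adj_cons eqxx.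
have [c [y ->]] := tconsP x; have := sP y.
rewrite !lift_faceE /outflow /inflow !count_map.
have face (f : m.-tuple bool * m.-tuple bool -> m.-tuple bool) :
    count (fun z => b :+: f z == c :+: y) s =
    if c == b then count (fun z => f z == y) s else 0.
  under eq_count do rewrite eq_tcons eq_sym.
  by case: eqP => //= _; rewrite count_pred0.
by rewrite !(face fst) !(face snd); case: eqP.
Qed.

End Lift.

Lemma flow_cross m b (k : m.-tuple bool -> nat) :
  flow (@hypercube_adj m.+1) (lift_face b (fun x => 2 * k x))
    (lift_face (~~ b) k).
Proof.
(* A configuration on a face is a sum of single piles, and [flow_move] handles each pile. *)
have pick c (F : m.-tuple bool -> nat) v :
    lift_face c F v = \sum_(x : m.-tuple bool) F x * (v == c :+: x).
  have [d [w ->]] := tconsP v; rewrite lift_faceE (bigD1 w) //= big1 => [|x].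
    by rewrite eq_tcons eqxx andbT addn0; case: (d == c); rewrite ?muln1 ?muln0.
  by rewrite eq_sym eq_tcons => /negPf->; rewrite andbF muln0.
pose P (x : m.-tuple bool) (v : m.+1.-tuple bool) := 2 * k x * (v == b :+: x).
pose Q (x : m.-tuple bool) (v : m.+1.-tuple bool) := k x * (v == ~~ b :+: x).
have moves : flow (@hypercube_adj m.+1) (fun v => \sum_x P x v) (fun v => \sum_x Q x v).
  apply: flow_sum => x; apply: flow_move.
  by rewrite hypercube_adj_cons; case: (b); rewrite eqxx.
apply: flow_trans (flow_trans moves _); apply: flow_le => v.
  by rewrite pick.
by rewrite pick.
Qed.

Lemma split_faces m b (p : m.+1.-tuple bool -> nat) x :
  p x = lift_face b (fun y => p (b :+: y)) x +
        lift_face (~~ b) (fun y => p (~~ b :+: y)) x.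
Proof.
have [c [y ->]] := tconsP x; rewrite !lift_faceE.
by case: b c => [] [] /=; rewrite ?addn0.
Qed.

Lemma lift_target m b (t : m.-tuple bool) j x :
  lift_face b (fun y => j * (y == t)) x = j * (x == b :+: t).
Proof.
have [c [y ->]] := tconsP x; rewrite lift_faceE eq_tcons.
by case: eqP => // _; rewrite muln0.
Qed.

(** * Pebbling the hypercube *)

(* Crossing pairs of pebbles out of a face does not change the number of odd
   piles in it: this is why the second part counts odd piles and not occupied
   vertices. *)
Lemma hypercube_pebbling m (p : m.-tuple bool -> nat) (t : m.-tuple bool) :
  (2 ^ m <= \sum_x p x ->
     flow (@hypercube_adj m) p (fun x => 1 * (x == t))) /\
  (2 ^ m.+1 < \sum_x p x + odd_number p ->
     flow (@hypercube_adj m) p (fun x => 2 * (x == t))).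
Proof.
elim: m p t => [|m IHm] p t.
  have eq_t x : x = t by rewrite (tuple0 x) (tuple0 t).
  have sum1 (F : 0.-tuple bool -> nat) : \sum_x F x = F t.
    by rewrite (bigD1 t) //= big1 ?addn0 // => x; rewrite (eq_t x) eqxx.
  rewrite /odd_number !sum1; split=> le_p; apply: flow_le => x.
    by rewrite (eq_t x) eqxx.
  by rewrite (eq_t x) eqxx; case: (p t) le_p => [|[|]].
(* [pA] lives on the face of the target, [pB] on the opposite one, where [a] marks the neighbour of
   the target. *)
have [b [a ->]] := tconsP t; pose pA y := p (b :+: y); pose pB y := p (~~ b :+: y).
have sum_p : \sum_x p x = \sum_y pA y + \sum_y pB y := sum_tupleS b p.
have odd_p : odd_number p = odd_number pA + odd_number pB := sum_tupleS b _.
have odd_le (q : m.-tuple bool -> nat) : odd_number q <= 2 ^ m.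
  rewrite -[2]card_bool -card_tuple -sum1_card; apply: leq_sum => x _.
  exact: leq_b1.
have odd_le_sum (q : m.-tuple bool -> nat) : odd_number q <= \sum_y q y.
  by rewrite -sum_half leq_addl.
have crossing (k : m.-tuple bool -> nat) : (forall y, 2 * k y <= pB y) ->
    flow (@hypercube_adj m.+1) p
      (fun x => lift_face b (fun y => pA y + k y) x +
                lift_face (~~ b) (fun y => pB y - 2 * k y) x).
  move=> le_k; have cross := flow_cross (~~ b) k; rewrite negbK in cross.
  pose q x := lift_face b pA x + lift_face (~~ b) (fun y => pB y - 2 * k y) x.
  have le_q := flow_le (@hypercube_adj m.+1) (fun x => leqnn (q x)).
  apply: flow_trans (flow_trans (flow_add le_q cross) _); apply: flow_le => x.
    rewrite (split_faces b p x) /q; have [c [y ->]] := tconsP x.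
    rewrite !lift_faceE; have := le_k y.
    by rewrite /pA /pB; case: (c) (b) => [] [] /=; lia.
  rewrite /q; have [c [y ->]] := tconsP x.
  by rewrite !lift_faceE; case: (c) (b) => [] [] /=; lia.
have onA j q : flow (@hypercube_adj m) q (fun y => j * (y == a)) ->
    flow (@hypercube_adj m.+1) (lift_face b q) (fun x => j * (x == b :+: a)).
  move=> qa; apply: flow_trans (flow_lift b qa) _.
  by apply: flow_le => x; rewrite lift_target.
have onB q : flow (@hypercube_adj m) q (fun y => 2 * (y == a)) ->
    flow (@hypercube_adj m.+1) (lift_face (~~ b) q) (fun x => 1 * (x == b :+: a)).
  move=> qa; have cross := flow_cross (~~ b) (fun y => 1 * (y == a)).
  rewrite negbK in cross.
  apply: flow_trans (flow_lift (~~ b) qa) (flow_trans (flow_trans _ cross) _).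
    by apply: flow_le => x; rewrite /lift_face; case: ifP; rewrite ?mul1n.
  by apply: flow_le => x; rewrite lift_target.
have twoAB j k qA qB :
    flow (@hypercube_adj m.+1) (lift_face b qA) (fun x => j * (x == b :+: a)) ->
    flow (@hypercube_adj m.+1) (lift_face (~~ b) qB) (fun x => k * (x == b :+: a)) ->
    flow (@hypercube_adj m.+1) (fun x => lift_face b qA x + lift_face (~~ b) qB x)
      (fun x => (j + k) * (x == b :+: a)).
  move=> fA fB; apply: flow_trans (flow_add fA fB) _.
  by apply: flow_le => x; rewrite mulnDl.
have nothing q : flow (@hypercube_adj m.+1) q (fun x => 0 * (x == b :+: a)).
  exact: flow_le.
have halves : flow (@hypercube_adj m.+1) p
    (fun x => lift_face b pA x + lift_face (~~ b) pB x).
  by apply: flow_le => x; rewrite (split_faces b p x).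
have sumD (q k : m.-tuple bool -> nat) :
    \sum_y (q y + k y) = \sum_y q y + \sum_y k y by rewrite big_split.
rewrite sum_p odd_p; split=> le_p.
  (* If the odd piles of [pB] outnumber the pebbles of [pA], then [pB] alone brings two pebbles next
     to the target. Otherwise all pairs of [pB] cross, and the target face gets at least 2 ^ m
     pebbles. *)
  have [lt_AB | le_BA] := ltnP (\sum_y pA y) (odd_number pB).
    apply: flow_trans halves (twoAB 0 1 _ _ (nothing _) (onB _ _)).
    by apply: (IHm pB a).2; move: le_p; rewrite expnS; lia.
  apply: flow_trans (crossing (fun y => (pB y)./2) _) _ => [y|].
    by rewrite mul2n -[leqRHS]odd_double_half leq_addl.
  apply: (twoAB 1 0 _ _ (onA _ _ _) (nothing _)).
  apply: (IHm _ a).1; rewrite sumD.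
  by have := sum_half pB; move: le_p; rewrite expnS; lia.
(* Either [pA] alone delivers both pebbles, or each face delivers one. In the latter case, if [pA]
   has fewer than 2 ^ m pebbles, just enough pairs cross to fill the deficit. *)
have [gt_A | le_A] := ltnP (2 ^ m.+1) (\sum_y pA y + odd_number pA).
  apply: flow_trans halves (twoAB 2 0 _ _ (onA _ _ _) (nothing _)).
  exact: (IHm pA a).2.
have [ge_A | lt_A] := leqP (2 ^ m) (\sum_y pA y).
  apply: flow_trans halves (twoAB 1 1 _ _ (onA _ _ _) (onB _ _)).
    exact: (IHm pA a).1.
  by apply: (IHm pB a).2; move: le_p le_A; rewrite !expnS; lia.
have := odd_le pB; have := odd_le_sum pA; have := sum_half pB => half_B odd_A odd_B.
have [|k le_k sum_k] := @exists_le_sum _ (fun y => (pB y)./2) (2 ^ m - \sum_y pA y).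
  (* There are enough pairs because [pB] has at most 2 ^ m odd piles. *)
  by move: le_p; rewrite !expnS; lia.
have {}le_k y : 2 * k y <= pB y by have := le_k y; lia.
apply: flow_trans (crossing k le_k) (twoAB 1 1 _ _ (onA _ _ _) (onB _ _)).
  by apply: (IHm _ a).1; rewrite sumD sum_k; lia.
apply: (IHm _ a).2.
have -> : odd_number (fun y => pB y - 2 * k y) = odd_number pB.
  by apply: eq_bigr => y _; rewrite oddB // mul2n odd_double addbF.
have : \sum_y (pB y - 2 * k y) + 2 * \sum_y k y = \sum_y pB y.
  rewrite big_distrr -big_split /=; apply: eq_bigr => y _.
  exact: subnK.
(* What remains suffices because [odd_number pA] is at most the number of pebbles of [pA]. *)
by move: le_p; rewrite sum_k !expnS; lia.
Qed.

(** * Pegging moves *)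

Lemma Reach_refl (G : sgraph) (D : {set vertex G}) t : t \in D -> t \in Reach D.
Proof. by move=> Dt; rewrite inE; apply/existsP; exists D; rewrite connect0. Qed.

Lemma Reach_step (G : sgraph) (D E : {set vertex G}) t :
  pegging_move D E -> t \in Reach E -> t \in Reach D.
Proof.
move=> DE; rewrite !inE => /existsP[F /andP[EF Ft]]; apply/existsP; exists F.
by rewrite Ft (connect_trans (connect1 DE) EF).
Qed.

Definition column m (D : {set m.+1.-tuple bool}) (x : m.-tuple bool) :=
  (true :+: x \in D) + (false :+: x \in D).

(* A column of two pegs acts as two pebbles. The pebbles of the column of the
   target are discarded, so that any peg jumping there may land on the target. *)
Lemma Reach_flow m (D : {set vertex (hypercube m.+1)}) b (t : m.-tuple bool) :
  flow (@hypercube_adj m) (fun x => if x == t then 0 else column D x)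
    (fun x => x == t) ->
  b :+: t \in Reach D.
Proof.
case=> s; move: {2}(size s) (leqnn (size s)) => k.
elim: k s D => [|k IHk] s D le_s fl; have [Dt | Dt] := boolP (b :+: t \in D);
    try exact: Reach_refl.
  by have [] := flow_capped_move _ fl; rewrite ?eqxx //; case: s le_s fl.
have [|[u w] s_uw /= /andP[]] := flow_capped_move _ fl; first by rewrite eqxx.
have [// | u_neq_t full_u le_w] := eqVneq u t.
have adj_uw : hypercube_adj u w by case: fl => /allP/(_ _ s_uw).
have u_neq_w : u != w by apply: contraTneq adj_uw => ->; rewrite hypercube_adj_irrefl.
have Du c : c :+: u \in D.
  by move: full_u; rewrite /column; case: c; do 2 case: (_ \in D).
(* A free height in the column of [w]; in the column of the target it is [b], free by [Dt]. *)
have [c Dc c_t] : exists2 c, c :+: w \notin D & w = t -> c = b.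
  case: (eqVneq w t) le_w => [-> _ | /eqP w_t]; first by exists b.
  rewrite /column; have [Dw | Dw] := boolP (true :+: w \in D); last by exists true.
  by move=> Dw'; exists false => //; move: Dw'; case: (_ \in D).
(* The peg at the other height of the full column jumps within the column over the peg at height
   [c], and lands in the next column at that height. *)
pose E := (c :+: w) |: (D :\: [set ~~ c :+: u; c :+: u]).
apply: (@Reach_step _ D E).
  apply/existsP; exists (~~ c :+: u); apply/existsP; exists (c :+: u).
  apply/existsP; exists (c :+: w).
  rewrite !Du Dc eqxx /= !hypercube_adj_cons !eqxx adj_uw.
  by case: (c).
have [wt | w_neq_t] := eqVneq w t.
  by apply: Reach_refl; rewrite !inE -wt c_t // eqxx.
have colE x : column D x + (x == w) <= column E x + 2 * (x == u).
  rewrite /column !inE !eq_tcons.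
  have [-> | x_neq_u] := eqVneq x u.
    rewrite (negPf u_neq_w) addn0; apply: leq_trans (leq_addl _ _).
    by do 2 case: (_ \in D).
  have [-> | x_neq_w] := eqVneq x w; last by rewrite !andbF.
  by move: Dc; case: (c) => /negPf->; rewrite !andbF /=; case: (_ \in D).
apply: IHk (flow_by_rem s_uw fl _).
  by rewrite size_rem //; case: (s) s_uw le_s.
move=> x /=; have := colE x; case: (eqVneq x t) => // -> _.
by rewrite eq_sym (negPf w_neq_t).
Qed.

Lemma sum_column m (D : {set m.+1.-tuple bool}) : \sum_x column D x = #|D|.
Proof.
rewrite -sum1_card [RHS]big_mkcond; apply: etrans (esym (sum_tupleS true _)).
by rewrite -big_split; apply: eq_bigr => x _; rewrite /column /=; do 2 case: (_ \in D).
Qed.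

Lemma hypercube_Reach m (D : {set vertex (hypercube m.+1)}) :
  2 ^ m < #|D| -> Reach D = [set: vertex (hypercube m.+1)].
Proof.
move=> gtD; apply/eqP; rewrite -subTset; apply/subsetP => x _.
have [b [t ->]] := tconsP x.
have [Dt | Dt] := boolP (b :+: t \in D); first exact: Reach_refl.
apply: Reach_flow; pose p x := if x == t then 0 else column D x.
suff: flow (@hypercube_adj m) p (fun x => 1 * (x == t)).
  by move=> pt; apply: flow_trans pt _; apply: flow_le => y; rewrite mul1n.
apply: (hypercube_pebbling p t).1.
have sumD := sum_column D; rewrite (bigD1 t) //= in sumD.
rewrite (bigD1 t) //= {1}/p eqxx add0n.
rewrite (eq_bigr (column D)) => [|y /negPf]; last by rewrite /p => ->.
(* The target is empty, so discarding its column costs at most one peg, which the strict bound on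
   [#|D|] pays for. *)
have : column D t <= 1.
  by move: Dt; rewrite /column; case: (b) => /negPf->; case: (_ \in D).
by move: gtD; rewrite -sumD; lia.
Qed.

(** * Independent sets *)

(** A jump needs two adjacent pegs, so no first move exists. *)
Lemma Reach_independent (G : sgraph) (D : {set vertex G}) :
  {in D &, forall u v, ~~ adj u v} -> Reach D = D.
Proof.
move=> indD; apply/setP => t; apply/idP/idP => [|]; last exact: Reach_refl.
rewrite inE => /existsP[E /andP[/connectP[[|F s] /= DF ->] //]].
case/andP: DF => /existsP[u /existsP[v /existsP[w /and5P[Du Dv uv _ _]]]].
by have := indD u v Du Dv; rewrite uv.
Qed.

Definition even_vertices m := [set x : m.-tuple bool | ~~ odd (count id x)].

Lemma hypercube_adj_parity m (x y : m.-tuple bool) :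
  hypercube_adj x y -> odd (count id x) = ~~ odd (count id y).
Proof.
elim: m x y => [|m IHm] x y.
  by rewrite (tuple0 x) (tuple0 y) hypercube_adj_irrefl.
have [b [x' ->]] := tconsP x; have [c [y' ->]] := tconsP y.
rewrite hypercube_adj_cons /= !oddD.
case: (eqVneq b c) => [-> /IHm-> | bc /eqP->]; first by rewrite addbN.
by move: bc; case: b c => [] [] //= _; rewrite negbK.
Qed.

(** Exactly one of the two vertices of each column is even. *)
Lemma card_even_vertices m : #|even_vertices m.+1| = 2 ^ m.
Proof.
rewrite -sum1dep_card big_mkcond; apply: etrans (sum_tupleS true _) _.
rewrite -big_split /=.
rewrite -[2]card_bool -card_tuple -sum1_card; apply: eq_bigr => x _.
by rewrite add0n; case: (odd _).
Qed.

Lemma exists_subset_card (T : finType) (A : {set T}) d :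
  d <= #|A| -> exists2 B : {set T}, B \subset A & #|B| = d.
Proof.
move=> le_d; exists [set x in take d (enum A)].
  by apply/subsetP => x; rewrite inE => /mem_take; rewrite mem_enum.
by rewrite cardsE (card_uniqP _) ?take_uniq ?enum_uniq // size_takel // -cardE.
Qed.

Theorem theorem5p1 (n : nat) (n_gt0 : 0 < n) :
  pegging_number (hypercube n) = 2 ^ (n - 1) + 1.
Proof.
case: n n_gt0 => // m _; rewrite subn1 addn1 /pegging_number /=.
case: ex_minnP => d /andP[d_gt0 /forallP dP] d_min.
apply/eqP; rewrite eqn_leq; apply/andP; split.
  apply: d_min; apply/forallP => D; apply/implyP => /eqP cardD.
  by rewrite hypercube_Reach ?cardD.
(* A [d] of at most 2 ^ m is the size of some set of even vertices. Such a set is independent, hence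
   its own reach, and too small to be the whole cube. *)
rewrite ltnNge; apply/negP; rewrite -card_even_vertices => /exists_subset_card.
case=> D /subsetP sDE cardD; have := dP D; rewrite cardD eqxx /=.
rewrite Reach_independent => [/eqP DT | u v /sDE Eu /sDE Ev].
  have := subset_leq_card (introT subsetP sDE).
  rewrite DT cardsT card_tuple card_bool card_even_vertices leq_exp2l //.
  by rewrite ltnn.
apply/negP => /hypercube_adj_parity; move: Eu Ev; rewrite !inE.
by move=> /negPf-> /negPf->.
Qed.
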